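(* Let $\alpha_1,\dots,\alpha_6$ be complex numbers with $\sum_{k=1}^{6}\alpha_k\neq 0$. Let $\mathcal{A}$ and $\mathcal{B}$ be two unital complex $\ast$-algebras with multiplicative identities $1_{\mathcal{A}}$ and $1_{\mathcal{B}}$, respectively, such that $\mathcal{A}$ is prime and has a nontrivial projection. Let $\Phi:\mathcal{A}\rightarrow\mathcal{B}$ be a bijective mapping (not assumed additive or linear) that preserves the sum of triple products $\alpha_1 ab^{*}c+\alpha_2 acb^{*}+\alpha_3 b^{*}ac+\alpha_4 cab^{*}+\alpha_5 b^{*}ca+\alpha_6 cb^{*}a$, i.e. $$\begin{aligned}&\Phi(\alpha_1 ab^{*}c+\alpha_2 acb^{*}+\alpha_3 b^{*}ac+\alpha_4 cab^{*}+\alpha_5 b^{*}ca+\alpha_6 cb^{*}a)\\ &=\alpha_1\Phi(a)\Phi(b)^{*}\Phi(c)+\alpha_2\Phi(a)\Phi(c)\Phi(b)^{*}+\alpha_3\Phi(b)^{*}\Phi(a)\Phi(c)\\ &\quad+\alpha_4\Phi(c)\Phi(a)\Phi(b)^{*}+\alpha_5\Phi(b)^{*}\Phi(c)\Phi(a)+\alpha_6\Phi(c)\Phi(b)^{*}\Phi(a)\end{aligned}$$ for all $a,b,c\in\mathcal{A}$. Suppose that $\Phi(1_{\mathcal{A}})$ is a projection and that at least one of the following conditions holds: (i) $\lambda:=(\alpha_1+\alpha_2+\alpha_3)-(\alpha_4+\alpha_5+\alpha_6)\neq 0$ and $\Phi(\lambda a)=\lambda\Phi(a)$ for all $a\in\mathcal{A}$;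 (ii) $\mu:=(\alpha_1+\alpha_3+\alpha_5)-(\alpha_2+\alpha_4+\alpha_6)\neq 0$ and $\Phi(\mu a)=\mu\Phi(a)$ for all $a\in\mathcal{A}$; (iii) $\kappa:=(\alpha_1+\alpha_2+\alpha_4)-(\alpha_3+\alpha_5+\alpha_6)\neq 0$ and $\Phi(\kappa a)=\kappa\Phi(a)$ for all $a\in\mathcal{A}$. Then $\Phi$ is a $\ast$-ring isomorphism.
   Context: A complex $\ast$-algebra is an associative complex algebra with a conjugate-linear involution $\ast$ satisfying $(ab)^*=b^*a^*$. A projection is an element $p$ with $p=p^*=p^2$; it is nontrivial if $p\neq 0$ and $p\neq 1$. An algebra is prime if $a\mathcal{A}b=\{0\}$ implies $a=0$ or $b=0$. A $\ast$-ring isomorphism is an additive bijection $\Phi$ with $\Phi(a^* )=\Phi(a)^*$ and $\Phi(ac)=\Phi(a)\Phi(c)$ for all $a,c$; complex linearity is not required. *)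

(* Defs.v *)
From HB Require Import structures.
From mathcomp Require Import all_boot all_order all_algebra.
From mathcomp Require Import complex reals.

Set Implicit Arguments.
Unset Strict Implicit.
Unset Printing Implicit Defensive.

Import GRing.Theory.
Local Open Scope ring_scope.
Local Open Scope complex_scope.

(* R[i] over a realType R is the field of complex numbers.  An algType is
   unital, associative, not assumed commutative, and has 1 != 0; the last point
   loses nothing below, where one algebra has a nontrivial projection and the
   other is in bijection with it. *)
HB.mixin Record isStarAlgebra (R : realType) A of GRing.Algebra R[i] A := {
  star : A -> A;
  starK : involutive star;
  starD : {morph star : x y / x + y};
  starZ : forall (k : R[i]) (x : A), star (k *: x) = conjc k *: star x;
  starM : forall x y : A, star (x * y) = star y * star x
}.

#[short(type="starAlgType")]
HB.structure Definition StarAlgebra (R : realType) :=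
  {A of GRing.Algebra R[i] A & isStarAlgebra R A}.

Definition projection (R : realType) (A : starAlgType R) (p : A) : Prop :=
  p = star p /\ p = p ^+ 2.

Definition nontrivial_projection (R : realType) (A : starAlgType R) (p : A) :
    Prop :=
  [/\ projection p, p <> 0 & p <> 1].

Definition prime_algebra (R : realType) (A : starAlgType R) : Prop :=
  forall a b : A, (forall x : A, a * x * b = 0) -> a = 0 \/ b = 0.

Definition sum_triple (R : realType) (A : starAlgType R)
    (alpha1 alpha2 alpha3 alpha4 alpha5 alpha6 : R[i]) (a b c : A) : A :=
  alpha1 *: (a * star b * c) + alpha2 *: (a * c * star b)
  + alpha3 *: (star b * a * c) + alpha4 *: (c * a * star b)
  + alpha5 *: (star b * c * a) + alpha6 *: (c * star b * a).

Definition star_ring_isomorphism (R : realType) (A B : starAlgType R)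
    (Phi : A -> B) : Prop :=
  [/\ bijective Phi,
      forall a c : A, Phi (a + c) = Phi a + Phi c,
      forall a : A, Phi (star a) = star (Phi a)
    & forall a c : A, Phi (a * c) = Phi a * Phi c].

(* Main.v *)
Require Import Defs.
From HB Require Import structures.
From mathcomp Require Import all_boot all_order all_algebra.
From mathcomp Require Import complex reals.

Import GRing.Theory.
Local Open Scope ring_scope.
Local Open Scope complex_scope.

Set Implicit Arguments.
Unset Strict Implicit.

(** Setting two of the three arguments of the triple product to 1 leaves
    [alpha *: x] or [alpha *: star x], where [alpha] is the sum of the six
    scalars.  Since [Phi] is onto, this forces the projection [Phi 1] to be 1
    ([Phi_unital]): every element of [B] has the form
    [r *: (x * e) + r' *: (e * x * e) + r'' *: (e * x)] with [e = Phi 1], so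
    its compression by [1 - e] vanishes.  With [Phi 1 = 1] the same identities
    show that [Phi] commutes with [alpha *: _] and with the involution.

    Setting only one argument to 1 leaves a mixed product
    [s *: (x * y) + t *: (y * x)] with [s + t = alpha], and the three choices
    of argument give for [s - t] the three scalars of the hypothesis.  So it is
    enough to study bijections that preserve one mixed product.

    Such a bijection is additive as soon as [s + t != 0]
    ([mix_isomorphism_additive]).  For [a] and [b] in [A], let [z] be the
    preimage of [Phi a + Phi b] minus [a + b].  Multiplying by [u] on either
    side shows that [z] is killed by both mixed products with [u], hence
    anticommutes with [u], whenever [Phi] is already known to be additive at
    the products of [a] and [b] with [u] ([additivity_defect]).  Taking for [u]
    idempotents or off-diagonal elements of a Peirce decomposition makes these
    products simpler than [a] and [b]; primeness then gives [z = 0].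
    Additivity thus spreads from pairs of Peirce components to all of [A].

    Once [Phi] is additive, adding and subtracting the identities for
    [(x, y)] and [(y, x)] shows that [Phi] preserves [x * y + y * x] and
    [x * y - y * x], because it commutes with the nonzero scalars [s + t] and
    [s - t] by which they come multiplied; hence it preserves
    twice the product ([mix_isomorphism_multiplicative]). *)

(** * Mixed products *)

Definition mix (F : fieldType) (A : algType F) (s t : F) (x y : A) : A :=
  s *: (x * y) + t *: (y * x).

Section MixedProduct.
Variables (F : fieldType) (A : algType F) (s t : F).

Lemma mixC (x y : A) : mix s t x y = mix t s y x.
Proof. by rewrite /mix addrC. Qed.

Lemma mixDl (x y z : A) : mix s t (x + y) z = mix s t x z + mix s t y z.
Proof. by rewrite /mix mulrDl mulrDr !scalerDr addrACA. Qed.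

Lemma mixDr (x y z : A) : mix s t x (y + z) = mix s t x y + mix s t x z.
Proof. by rewrite /mix mulrDl mulrDr !scalerDr addrACA. Qed.

Lemma mix0l (x : A) : mix s t 0 x = 0.
Proof. by rewrite /mix mul0r mulr0 !scaler0 addr0. Qed.

Lemma mix0r (x : A) : mix s t x 0 = 0.
Proof. by rewrite /mix mul0r mulr0 !scaler0 addr0. Qed.

End MixedProduct.

(** * Complementary idempotents and their corners *)

(** Idempotence of [e] and [f] follows from these three equations, and their
    symmetry in [e] and [f] is what makes each statement on the corners usable
    with the two idempotents exchanged. *)
Definition complementary (A : nzRingType) (e f : A) : Prop :=
  [/\ e * f = 0, f * e = 0 & e + f = 1].

(** For idempotents [e] and [f] this is the Peirce component [e A f]. *)
Definition corner (A : nzRingType) (e f x : A) : Prop :=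
  e * x = x /\ x * f = x.

Section Corners.
Variable A : nzRingType.
Implicit Types e f x y z : A.

Lemma complementaryC e f : complementary e f -> complementary f e.
Proof. by case=> ef fe ef1; split; rewrite // addrC. Qed.

Lemma complementary_idem e f : complementary e f -> e * e = e.
Proof. by case=> ef _ ef1; rewrite -{3}[e]mulr1 -ef1 mulrDr ef addr0. Qed.

Lemma complementary_killl e f x : complementary e f -> e * x = x -> f * x = 0.
Proof. by case=> _ fe _ <-; rewrite mulrA fe mul0r. Qed.

Lemma complementary_killr e f x : complementary e f -> x * e = x -> x * f = 0.
Proof. by case=> ef _ _ <-; rewrite -mulrA ef mulr0. Qed.

Lemma complementary_fixl e f x : complementary e f -> f * x = 0 -> e * x = x.
Proof. by case=> _ _ ef1 fx; rewrite -[RHS]mul1r -ef1 mulrDl fx addr0. Qed.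

Lemma complementary_fixr e f x : complementary e f -> x * f = 0 -> x * e = x.
Proof. by case=> _ _ ef1 xf; rewrite -[RHS]mulr1 -ef1 mulrDr xf addr0. Qed.

Lemma complementary_eq0 e f x :
  complementary e f -> e * x = 0 -> f * x = 0 -> x = 0.
Proof. by move=> cef ex fx; rewrite -(complementary_fixl cef fx). Qed.

Lemma corner_cut e f x : e * e = e -> f * f = f -> corner e f (e * x * f).
Proof. by move=> ee ff; split; [rewrite !mulrA ee | rewrite -!mulrA ff]. Qed.

Lemma cornerM e f g x y : corner e f x -> corner f g y -> corner e g (x * y).
Proof.
by case=> ex _ [_ yg]; split; [rewrite mulrA ex | rewrite -mulrA yg].
Qed.

Lemma cornerM0 e f g h x y :
  f * g = 0 -> corner e f x -> corner g h y -> x * y = 0.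
Proof. by move=> fg [_ <-] [<- _]; rewrite -mulrA (mulrA f) fg mul0r mulr0. Qed.

Lemma peirce_decomposition e f x : complementary e f ->
  x = (e * x * e + f * x * f) + (e * x * f + f * x * e).
Proof.
case=> _ _ ef1; rewrite -{1}[x]mul1r -[1 * x]mulr1 -ef1 !mulrDl !mulrDr.
by rewrite [f * x * e + _]addrC addrACA.
Qed.

End Corners.

Lemma cornerZ (F : fieldType) (A : algType F) (e f x : A) k :
  corner e f x -> corner e f (k *: x).
Proof. by case=> ex xf; split; rewrite -?(scalerAr, scalerAl) ?ex ?xf. Qed.

(** Multiplying [e * z = - (z * e)] by [e] on either side expresses both
    [e * z] and [z * e] as [- (e * z * e)]; they are equal and opposite. *)
Lemma anticommute_idem (F : numFieldType) (A : algType F) (e z : A) :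
  e * e = e -> e * z + z * e = 0 -> e * z = 0 /\ z * e = 0.
Proof.
move=> ee anti.
have ezN : e * z = - (z * e) by apply/eqP; rewrite -addr_eq0 anti.
have ez_eq_ze : e * z = z * e.
  have zeN : z * e = - (e * z) by rewrite ezN opprK.
  have l : e * z = - (e * z * e) by rewrite -{1}ee -mulrA {1}ezN mulrN mulrA.
  have r : z * e = - (e * z * e) by rewrite -{1}ee mulrA {1}zeN mulNr.
  by rewrite l r.
have ez0 : e * z = 0.
  apply: (scalerI (a := 2)); first by rewrite Num.Theory.pnatr_eq0.
  by rewrite scaler0 scaler_nat mulr2n {2}ez_eq_ze anti.
by rewrite -ez_eq_ze ez0.
Qed.

(** * Additivity of bijections preserving a mixed product *)

Section Additivity.
Variables (F : numFieldType) (A B : algType F) (s t : F).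
Hypothesis st_neq0 : s + t != 0.
Hypothesis primeA : forall a b : A, (forall x, a * x * b = 0) -> a = 0 \/ b = 0.
Variable Phi : A -> B.
Hypothesis Phi_bij : bijective Phi.
Hypothesis Phi_mix : forall x y, Phi (mix s t x y) = mix s t (Phi x) (Phi y).

Local Notation "x <o> y" := (mix s t x y) (at level 40, left associativity).

Definition additive_at (a b : A) : Prop := Phi (a + b) = Phi a + Phi b.

Lemma Phi0 : Phi 0 = 0.
Proof.
case: Phi_bij => g _ gK.
by rewrite -(mix0l s t (g 0)) Phi_mix gK mix0r.
Qed.

Lemma additive_atC a b : additive_at a b -> additive_at b a.
Proof. by rewrite /additive_at addrC => ->; rewrite addrC. Qed.

Lemma additive_at0l a : additive_at 0 a.
Proof. by rewrite /additive_at Phi0 !add0r. Qed.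

Lemma additive_at0r a : additive_at a 0.
Proof. exact/additive_atC/additive_at0l. Qed.

(** [z] is the preimage of [Phi a + Phi b] minus [a + b].  Applying [Phi] to
    the products of that preimage with [u] gives [z <o> u = 0] and
    [u <o> z = 0], whose sum is [(s + t) *: (u * z + z * u)]; keeping only this
    sum avoids any case distinction on which of [s] and [t] vanish.  The
    second clause detects [z] through products at which additivity is not yet
    known, but which coincide on the left and on the right. *)
Lemma additivity_defect a b : exists z : A,
  [/\ forall u, additive_at (a <o> u) (b <o> u) ->
        additive_at (u <o> a) (u <o> b) -> u * z + z * u = 0,
      forall u v, u <o> a = a <o> v -> u <o> b = b <o> v -> u <o> z = z <o> v
    & z = 0 -> additive_at a b].
Proof.
case: (Phi_bij) => g gK Kg.
pose x := g (Phi a + Phi b); have Phix : Phi x = Phi a + Phi b by rewrite Kg.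
have [z xE] : exists z, x = (a + b) + z.
  by exists (x - (a + b)); rewrite addrC subrK.
have Phi_inj := can_inj gK.
have Phixl u : Phi (x <o> u) = Phi (a <o> u) + Phi (b <o> u).
  by rewrite !Phi_mix Phix mixDl.
have Phixr u : Phi (u <o> x) = Phi (u <o> a) + Phi (u <o> b).
  by rewrite !Phi_mix Phix mixDr.
exists z; split.
- move=> u addl addr.
  have zu : z <o> u = 0.
    apply: (addrI ((a + b) <o> u)); rewrite -mixDl -xE addr0.
    by apply: Phi_inj; rewrite Phixl mixDl addl.
  have uz : u <o> z = 0.
    apply: (addrI (u <o> (a + b))); rewrite -mixDr -xE addr0.
    by apply: Phi_inj; rewrite Phixr mixDr addr.
  (* the two mixed products of [u] and [z] add up to [s + t] times the
     Jordan product *)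
  apply: (scalerI st_neq0).
  transitivity (u <o> z + z <o> u); last by rewrite uz zu scaler0 addr0.
  by rewrite /mix scalerDl !scalerDr [t *: _ + _]addrC addrACA.
- move=> u v ua ub.
  apply: (addrI ((a + b) <o> v)); rewrite -mixDl -xE mixDl -ua -ub -mixDr.
  by rewrite -mixDr -xE; apply: Phi_inj; rewrite Phixr Phixl ua ub.
- by move=> z0; rewrite /additive_at -Phix xE z0 addr0.
Qed.

(** In the names and comments below, the indices 1 and 2 stand for [e] and [f]:
    the component 12, for instance, is [corner e f].  As [e] and [f] can be
    exchanged, each result also covers its mirror image. *)

Section Pair.
Variables e f : A.
Hypotheses (cef : complementary e f) (f_neq0 : f <> 0).

Let cfe : complementary f e := complementaryC cef.
Let ef0 : e * f = 0. Proof. by case: cef. Qed.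
Let fe0 : f * e = 0. Proof. by case: cef. Qed.
Let ee : e * e = e := complementary_idem cef.
Let ff : f * f = f := complementary_idem cfe.

(** Since [z * e = z], the hypothesis says that [z * x * f = 0] for all [x];
    primeness and [f <> 0] give [z = 0]. *)
Lemma corner_faithfulr z :
  z * e = z -> (forall w, corner e f w -> z * w = 0) -> z = 0.
Proof.
move=> ze zw; case: (@primeA z f) => // x.
by rewrite -ze -(mulrA z e) -(mulrA z (e * x)) zw //; apply: corner_cut.
Qed.

Lemma corner_faithfull z :
  e * z = z -> (forall w, corner f e w -> w * z = 0) -> z = 0.
Proof.
move=> ez wz; case: (@primeA f z) => // x.
by rewrite -ez mulrA wz //; apply: corner_cut.
Qed.

Lemma defect_corner z : f * z + z * f = 0 -> corner e e z.
Proof.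
case/anticommute_idem=> // fz zf.
by split; [apply: complementary_fixl fz | apply: complementary_fixr zf].
Qed.

Lemma defect_eq0 z : e * z + z * e = 0 -> f * z + z * f = 0 -> z = 0.
Proof.
case/anticommute_idem=> // ez _ /anticommute_idem[] // fz _.
exact: complementary_eq0 ez fz.
Qed.

Lemma mix_f_11 a : corner e e a -> f <o> a = 0 /\ a <o> f = 0.
Proof.
case=> ea ae; have fa := complementary_killl cef ea.
have af := complementary_killr cef ae.
by rewrite /mix fa af !scaler0 addr0.
Qed.

Lemma mix_e_11 a : corner e e a ->
  e <o> a = (s + t) *: a /\ a <o> e = (s + t) *: a.
Proof. by case=> ea ae; rewrite /mix ea ae scalerDl. Qed.

Lemma mix_e_12 b : corner e f b -> e <o> b = s *: b /\ b <o> e = t *: b.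
Proof.
case=> eb bf; rewrite /mix eb (complementary_killr cfe bf).
by rewrite !scaler0 addr0 add0r.
Qed.

Lemma mix_f_12 b : corner e f b -> f <o> b = t *: b /\ b <o> f = s *: b.
Proof.
case=> eb bf; rewrite /mix bf (complementary_killl cef eb).
by rewrite !scaler0 addr0 add0r.
Qed.

Lemma mix_12_12 b w : corner e f b -> corner e f w -> b <o> w = 0.
Proof.
move=> cb cw.
by rewrite /mix (cornerM0 fe0 cb cw) (cornerM0 fe0 cw cb) !scaler0 addr0.
Qed.

Lemma mix_11_12 a w : corner e e a -> corner e f w ->
  a <o> w = s *: (a * w) /\ w <o> a = t *: (a * w).
Proof.
move=> ca cw.
by rewrite /mix (cornerM0 fe0 cw ca) !scaler0 addr0 add0r.
Qed.

End Pair.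

(** The product of [f] with [a] vanishes, so the defect [z] lies in component
    11.  Elements [w] of component 12 have zero products with [b], so
    [w * z + z * w = 0]; here [w * z = 0] for free, and [z * w = 0] for all
    such [w] is what primeness needs. *)
Lemma additive_11_12 e f a b : complementary e f -> f <> 0 ->
  corner e e a -> corner e f b -> additive_at a b.
Proof.
move=> cef f0 ca cb; have [z [defect _]] := additivity_defect a b; apply.
have fe0 : f * e = 0 by case: cef.
have cz : corner e e z.
  have [fa af] := mix_f_11 cef ca.
  apply: (defect_corner cef); apply: defect; rewrite ?fa ?af;
  exact: additive_at0l.
apply: (corner_faithfulr cef f0) => [|w cw]; first by case: cz.
rewrite -[RHS](defect w) ?(cornerM0 fe0 cw cz) ?add0r //.
  by rewrite [b <o> w](mix_12_12 cef cb cw); apply: additive_at0r.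
by rewrite [w <o> b](mix_12_12 cef cw cb); apply: additive_at0r.
Qed.

Lemma additive_11_21 e f a c : complementary e f -> f <> 0 ->
  corner e e a -> corner f e c -> additive_at a c.
Proof.
move=> cef f0 ca cc; have [z [defect _]] := additivity_defect a c; apply.
have ef0 : e * f = 0 by case: cef.
have cfe := complementaryC cef.
have cz : corner e e z.
  have [fa af] := mix_f_11 cef ca.
  apply: (defect_corner cef); apply: defect; rewrite ?fa ?af;
  exact: additive_at0l.
apply: (corner_faithfull cef f0) => [|w cw]; first by case: cz.
rewrite -[RHS](defect w) ?(cornerM0 ef0 cz cw) ?addr0 //.
  by rewrite [c <o> w](mix_12_12 cfe cc cw); apply: additive_at0r.
by rewrite [w <o> c](mix_12_12 cfe cw cc); apply: additive_at0r.
Qed.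

(** Each of [e] and [f] has zero products with one of [a] and [d]. *)
Lemma additive_11_22 e f a d : complementary e f ->
  corner e e a -> corner f f d -> additive_at a d.
Proof.
move=> cef ca cd; have [z [defect _]] := additivity_defect a d; apply.
have cfe := complementaryC cef.
have [fa af] := mix_f_11 cef ca; have [ed de] := mix_f_11 cfe cd.
apply: (defect_eq0 cef); apply: defect.
- by rewrite de; apply: additive_at0r.
- by rewrite ed; apply: additive_at0r.
- by rewrite af; apply: additive_at0l.
- by rewrite fa; apply: additive_at0l.
Qed.

(** Products with [e] and [f] only rescale [b] and [c], so they bring the
    problem back to itself.  However [f <o> b = b <o> e] and
    [f <o> c = c <o> e], so the defect satisfies [f <o> z = z <o> e], and this
    kills its diagonal.  Its off-diagonal part is reached with elements of
    components 12 and 21, which have zero products with [b] and [c]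
    respectively. *)
Lemma additive_12_21 e f b c : complementary e f -> e <> 0 -> f <> 0 ->
  corner e f b -> corner f e c -> additive_at b c.
Proof.
move=> cef e0 f0 cb cc; have [z [defect twist]] := additivity_defect b c; apply.
have [ef0 fe0 ef1] := cef; have cfe := complementaryC cef.
have ee := complementary_idem cef; have ff := complementary_idem cfe.
have zt : f <o> z = z <o> e.
  apply: twist.
    by rewrite (proj1 (mix_f_12 cef cb)) (proj2 (mix_e_12 cef cb)).
  by rewrite (proj1 (mix_e_12 cfe cc)) (proj2 (mix_f_12 cfe cc)).
have eze : e * z * e = 0.
  have fz0 : e * (f <o> z) * e = 0.
    rewrite /mix mulrDr mulrDl -!(scalerAr, scalerAl) !mulrA ef0 -!mulrA fe0.
    by rewrite !(mul0r, mulr0) !scaler0 addr0.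
  have ze_scaled : e * (z <o> e) * e = (s + t) *: (e * z * e).
    rewrite /mix mulrDr mulrDl -!(scalerAr, scalerAl) !mulrA ee.
    by rewrite -!mulrA ee scalerDl.
  by apply: (scalerI st_neq0); rewrite -ze_scaled -zt fz0 scaler0.
have fzf : f * z * f = 0.
  have ze0 : f * (z <o> e) * f = 0.
    rewrite /mix mulrDr mulrDl -!(scalerAr, scalerAl) !mulrA fe0 -!mulrA ef0.
    by rewrite !(mul0r, mulr0) !scaler0 addr0.
  have fz_scaled : f * (f <o> z) * f = (s + t) *: (f * z * f).
    rewrite /mix mulrDr mulrDl -!(scalerAr, scalerAl) !mulrA ff.
    by rewrite -!mulrA ff scalerDl.
  by apply: (scalerI st_neq0); rewrite -fz_scaled zt ze0 scaler0.
have anti12 w : corner e f w -> w * z + z * w = 0.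
  move=> cw; apply: defect.
    by rewrite (mix_12_12 cef cb cw); apply: additive_at0l.
  by rewrite (mix_12_12 cef cw cb); apply: additive_at0l.
have anti21 w : corner f e w -> w * z + z * w = 0.
  move=> cw; apply: defect.
    by rewrite (mix_12_12 cfe cc cw); apply: additive_at0r.
  by rewrite (mix_12_12 cfe cw cc); apply: additive_at0r.
have fze : f * z * e = 0.
  apply: (corner_faithfulr cef f0) => [|w cw].
    by rewrite -(mulrA (f * z)) ee.
  have /(congr1 (fun y => f * y)) := anti12 w cw; rewrite mulrDr mulr0 mulrA.
  rewrite (complementary_killl cef (proj1 cw)) mul0r add0r => <-.
  by rewrite -(mulrA (f * z)) (proj1 cw) mulrA.
have ezf : e * z * f = 0.
  apply: (corner_faithfulr cfe e0) => [|w cw].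
    by rewrite -(mulrA (e * z)) ff.
  have /(congr1 (fun y => e * y)) := anti21 w cw; rewrite mulrDr mulr0 mulrA.
  rewrite (complementary_killl cfe (proj1 cw)) mul0r add0r => <-.
  by rewrite -(mulrA (e * z)) (proj1 cw) mulrA.
by rewrite (peirce_decomposition z cef) eze fzf ezf fze !addr0.
Qed.

(** Products with [e] delete [d] and products with [f] delete [a], which leaves
    pairs of components already treated; the defect then has to lie in both
    components 11 and 22. *)
Lemma additive_12_diagonal e f a b d : complementary e f -> e <> 0 -> f <> 0 ->
  corner e e a -> corner e f b -> corner f f d -> additive_at b (a + d).
Proof.
move=> cef e0 f0 ca cb cd; have [z [defect _]] := additivity_defect b (a + d).
apply; have cfe := complementaryC cef.
have [ea ae] := mix_e_11 ca; have [fa af] := mix_f_11 cef ca.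
have [fd df] := mix_e_11 cd; have [ed de] := mix_f_11 cfe cd.
have [eb be] := mix_e_12 cef cb; have [fb bf] := mix_f_12 cef cb.
have add1 k l : additive_at (k *: b) (l *: a).
  by apply/additive_atC/(additive_11_12 cef f0); apply: cornerZ.
have add2 k l : additive_at (k *: b) (l *: d).
  by apply/additive_atC/(additive_11_21 cfe e0); apply: cornerZ.
apply: (defect_eq0 cef); apply: defect; rewrite ?mixDl ?mixDr.
- by rewrite be ae de addr0.
- by rewrite eb ea ed addr0.
- by rewrite bf af df add0r.
- by rewrite fb fa fd add0r.
Qed.

(** As for [additive_11_12], the defect is tested on [w] in component 12.
    Now [a <o> w] is in component 12, while [(b + c) <o> w = c <o> w] is
    diagonal: this is the case treated by [additive_12_diagonal]. *)
Lemma additive_11_offdiagonal e f a b c :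
  complementary e f -> e <> 0 -> f <> 0 ->
  corner e e a -> corner e f b -> corner f e c -> additive_at a (b + c).
Proof.
move=> cef e0 f0 ca cb cc; have [z [defect _]] := additivity_defect a (b + c).
apply; have cfe := complementaryC cef; have [ef0 fe0 _] := cef.
have cz : corner e e z.
  have [fa af] := mix_f_11 cef ca.
  apply: (defect_corner cef); apply: defect; rewrite ?fa ?af;
  exact: additive_at0l.
apply: (corner_faithfulr cef f0) => [|w cw]; first by case: cz.
have [aw wa] := mix_11_12 cef ca cw.
have caw := cornerM ca cw.
have cwc := cornerM cw cc.
have ccw := cornerM cc cw.
rewrite -[RHS](defect w) ?(cornerM0 fe0 cw cz) ?add0r //.
  rewrite mixDl (mix_12_12 cef cb cw) add0r aw /mix addrC.
  by apply: (additive_12_diagonal cef) => //; apply: cornerZ.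
rewrite mixDr (mix_12_12 cef cw cb) add0r wa /mix.
by apply: (additive_12_diagonal cef) => //; apply: cornerZ.
Qed.

Lemma additive_diagonal_offdiagonal e f a b c d :
  complementary e f -> e <> 0 -> f <> 0 ->
  corner e e a -> corner e f b -> corner f e c -> corner f f d ->
  additive_at (a + d) (b + c).
Proof.
move=> cef e0 f0 ca cb cc cd.
have [z [defect _]] := additivity_defect (a + d) (b + c); apply.
have cfe := complementaryC cef.
have [ea ae] := mix_e_11 ca; have [fa af] := mix_f_11 cef ca.
have [fd df] := mix_e_11 cd; have [ed de] := mix_f_11 cfe cd.
have [eb be] := mix_e_12 cef cb; have [fb bf] := mix_f_12 cef cb.
have [fc cf] := mix_e_12 cfe cc; have [ec ce] := mix_f_12 cfe cc.
have add1 k l m : additive_at (k *: a) (l *: b + m *: c).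
  by apply: (additive_11_offdiagonal cef) => //; apply: cornerZ.
have add2 k l m : additive_at (k *: d) (l *: b + m *: c).
  by rewrite addrC; apply: (additive_11_offdiagonal cfe) => //; apply: cornerZ.
apply: (defect_eq0 cef); apply: defect; rewrite !(mixDl, mixDr).
- by rewrite ae de be ce addr0.
- by rewrite ea ed eb ec addr0.
- by rewrite af df bf cf add0r.
- by rewrite fa fd fb fc add0r.
Qed.

Lemma Phi_peirce_decomposition e f x : complementary e f -> e <> 0 -> f <> 0 ->
  Phi x = (Phi (e * x * e) + Phi (f * x * f))
          + (Phi (e * x * f) + Phi (f * x * e)).
Proof.
move=> cef e0 f0; rewrite {1}(peirce_decomposition x cef).
have ee := complementary_idem cef.
have ff := complementary_idem (complementaryC cef).
rewrite (additive_diagonal_offdiagonal cef) //; try exact: corner_cut.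
rewrite (additive_11_22 cef) //; try exact: corner_cut.
by rewrite (additive_12_21 cef) //; exact: corner_cut.
Qed.

(** A sum inside component 12 is a product of sums at which [Phi] is known to
    be additive: [(e + w) <o> (f + w') = s *: (w' + w)]. *)
Lemma additive_12 e f b b' : s != 0 -> complementary e f -> e <> 0 -> f <> 0 ->
  corner e f b -> corner e f b' -> additive_at b b'.
Proof.
move=> s0 cef e0 f0 cb cb'; have cfe := complementaryC cef.
have [ef0 fe0 _] := cef.
have ee := complementary_idem cef; have ff := complementary_idem cfe.
have scaled w w' : corner e f w -> corner e f w' ->
    additive_at (s *: w) (s *: w').
  move=> cw cw'; rewrite /additive_at addrC.
  have ef_mix : e <o> f = 0 by rewrite /mix ef0 fe0 !scaler0 addr0.
  have prodE : (e + w) <o> (f + w') = s *: w' + s *: w.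
    rewrite mixDl !mixDr ef_mix add0r (proj1 (mix_e_12 cef cw')).
    by rewrite (proj2 (mix_f_12 cef cw)) (mix_12_12 cef cw cw') addr0.
  rewrite -prodE Phi_mix (additive_11_12 cef f0 (conj ee ee) cw).
  rewrite (additive_11_21 cfe e0 (conj ff ff) cw') mixDl !mixDr -!Phi_mix.
  rewrite ef_mix (proj1 (mix_e_12 cef cw')) (proj2 (mix_f_12 cef cw)).
  by rewrite (mix_12_12 cef cw cw') Phi0 add0r addr0 addrC.
have unscale x : s *: (s^-1 *: x) = x by rewrite scalerA divff ?scale1r.
by rewrite -[b]unscale -[b']unscale; apply: scaled; apply: cornerZ.
Qed.

(** The products of [a] and [a'] with component 12 stay in component 12, where
    [Phi] is additive. *)
Lemma additive_11 e f a a' : s != 0 -> complementary e f -> e <> 0 -> f <> 0 ->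
  corner e e a -> corner e e a' -> additive_at a a'.
Proof.
move=> s0 cef e0 f0 ca ca'.
have [z [defect _]] := additivity_defect a a'; apply.
have fe0 : f * e = 0 by case: cef.
have cz : corner e e z.
  have [fa af] := mix_f_11 cef ca.
  apply: (defect_corner cef); apply: defect; rewrite ?fa ?af;
  exact: additive_at0l.
apply: (corner_faithfulr cef f0) => [|w cw]; first by case: cz.
have [aw wa] := mix_11_12 cef ca cw.
have [a'w wa'] := mix_11_12 cef ca' cw.
have caw := cornerM ca cw; have ca'w := cornerM ca' cw.
rewrite -[RHS](defect w) ?(cornerM0 fe0 cw cz) ?add0r //.
  by rewrite aw a'w; apply: (additive_12 s0 cef) => //; apply: cornerZ.
by rewrite wa wa'; apply: (additive_12 s0 cef) => //; apply: cornerZ.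
Qed.

Lemma mix_additive (e f x y : A) : s != 0 -> complementary e f ->
  e <> 0 -> f <> 0 -> additive_at x y.
Proof.
move=> s0 cef e0 f0; have cfe := complementaryC cef.
have ee := complementary_idem cef; have ff := complementary_idem cfe.
rewrite /additive_at (Phi_peirce_decomposition (x + y) cef e0 f0).
rewrite !(mulrDr, mulrDl).
rewrite (Phi_peirce_decomposition x cef e0 f0).
rewrite (Phi_peirce_decomposition y cef e0 f0).
rewrite (additive_11 s0 cef) //; try exact: corner_cut.
rewrite (additive_11 s0 cfe) //; try exact: corner_cut.
rewrite (additive_12 s0 cef) //; try exact: corner_cut.
rewrite (additive_12 s0 cfe) //; try exact: corner_cut.
rewrite [RHS]addrACA; congr (_ + _); exact: addrACA.
Qed.

End Additivity.

(** At least one of [s] and [t] is nonzero.  The hypothesis on [Phi] is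
    unchanged when they are exchanged together with the factors, so [s] may be
    taken nonzero. *)
Lemma mix_isomorphism_additive (F : numFieldType) (A B : algType F) (s t : F)
    (p : A) (Phi : A -> B) :
  s + t != 0 ->
  (forall a b : A, (forall x, a * x * b = 0) -> a = 0 \/ b = 0) ->
  p * p = p -> p <> 0 -> p <> 1 ->
  bijective Phi ->
  (forall x y, Phi (mix s t x y) = mix s t (Phi x) (Phi y)) ->
  forall x y, Phi (x + y) = Phi x + Phi y.
Proof.
move=> st0 primeA pp p0 p1 Phi_bij Phi_mix x y.
have cp : complementary p (1 - p).
  by split; rewrite ?mulrBr ?mulrBl ?mulr1 ?mul1r ?pp ?subrr // addrC subrK.
have q0 : 1 - p <> 0 by move=> /eqP; rewrite subr_eq0 => /eqP/esym.
have [s0|s0] := eqVneq s 0; last first.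
  exact: (mix_additive st0 primeA Phi_bij Phi_mix x y s0 cp).
apply: (mix_additive (s := t) (t := s) _ primeA Phi_bij _ x y _ cp) => //.
- by rewrite addrC.
- by move=> u v; rewrite mixC Phi_mix mixC.
- by move: st0; rewrite s0 add0r.
Qed.

(** * Multiplicativity *)

(** The sum of the mixed products of [(x, y)] and [(y, x)] is [s + t] times
    the Jordan product, their difference is [s - t] times the Lie bracket, and
    the sum of the last two is twice the product. *)
Lemma mix_isomorphism_multiplicative (F : numFieldType) (A B : algType F)
    (s t : F) (Phi : A -> B) :
  s + t != 0 -> s - t != 0 ->
  (forall x y, Phi (x + y) = Phi x + Phi y) ->
  (forall x, Phi ((s + t) *: x) = (s + t) *: Phi x) ->
  (forall x, Phi ((s - t) *: x) = (s - t) *: Phi x) ->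
  (forall x y, Phi (mix s t x y) = mix s t (Phi x) (Phi y)) ->
  forall x y, Phi (x * y) = Phi x * Phi y.
Proof.
move=> st0 dt0 PhiD PhiS PhiDl Phi_mix x y.
have Phi0 : Phi 0 = 0 by apply: (addrI (Phi 0)); rewrite -PhiD !addr0.
have PhiN u : Phi (- u) = - Phi u.
  by apply: (addrI (Phi u)); rewrite -PhiD !subrr.
have mix_sum (C : algType F) (u v : C) :
    mix s t u v + mix s t v u = (s + t) *: (u * v + v * u).
  by rewrite /mix scalerDl !scalerDr [t *: _ + _]addrC addrACA.
have mix_diff (C : algType F) (u v : C) :
    mix s t u v - mix s t v u = (s - t) *: (u * v - v * u).
  rewrite /mix scalerBl !scalerBr opprD opprB !addrA.
  rewrite -!addrA; congr (_ + _).
  by rewrite addrCA; congr (_ + _); rewrite addrC.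
have jordan : Phi (x * y) + Phi (y * x) = Phi x * Phi y + Phi y * Phi x.
  apply: (scalerI st0).
  by rewrite -PhiD -PhiS -!mix_sum PhiD !Phi_mix.
have lie : Phi (x * y) - Phi (y * x) = Phi x * Phi y - Phi y * Phi x.
  apply: (scalerI dt0).
  by rewrite -PhiN -PhiD -PhiDl -!mix_diff PhiD PhiN !Phi_mix.
apply: (scalerI (a := 2)); first by rewrite Num.Theory.pnatr_eq0.
have double (C : algType F) (u v : C) : 2 *: u = (u + v) + (u - v).
  by rewrite scaler_nat mulr2n addrACA subrr addr0.
by rewrite (double _ _ (Phi (y * x))) (double _ _ (Phi y * Phi x)) jordan lie.
Qed.

(** * Reduction of the triple product to mixed products *)

Section Triple.
Variables (R : realType) (al1 al2 al3 al4 al5 al6 : R[i]) (A B : starAlgType R).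
Variable Phi : A -> B.
Local Notation alpha := (al1 + al2 + al3 + al4 + al5 + al6).
Local Notation triple := (sum_triple al1 al2 al3 al4 al5 al6).
Hypothesis alpha_neq0 : alpha != 0.
Hypothesis Phi_bij : bijective Phi.
Hypothesis Phi_triple :
  forall a b c : A, Phi (triple a b c) = triple (Phi a) (Phi b) (Phi c).
Hypothesis Phi1_proj : projection (Phi 1).

Lemma star1 (C : starAlgType R) : star (1 : C) = 1.
Proof. by rewrite -[RHS]starK -[in RHS](mulr1 (star 1)) starM starK mulr1. Qed.

Lemma triple_x11 (C : starAlgType R) (x : C) : triple x 1 1 = alpha *: x.
Proof. by rewrite /sum_triple star1 !mulr1 !mul1r -!scalerDl. Qed.

Lemma triple_1x1 (C : starAlgType R) (x : C) : triple 1 x 1 = alpha *: star x.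
Proof. by rewrite /sum_triple !mulr1 !mul1r -!scalerDl. Qed.

Lemma triple_x1y (C : starAlgType R) (x y : C) :
  triple x 1 y = mix (al1 + al2 + al3) (al4 + al5 + al6) x y.
Proof.
by rewrite /sum_triple /mix star1 !mulr1 !mul1r !scalerDl !addrA.
Qed.

Lemma triple_1xy (C : starAlgType R) (x y : C) :
  triple 1 (star x) y = mix (al1 + al3 + al5) (al2 + al4 + al6) x y.
Proof.
rewrite /sum_triple /mix starK !mulr1 !mul1r !scalerDl !addrA.
rewrite [in LHS](addrAC _ _ (al3 *: _)) [in LHS](addrAC _ _ (al5 *: _)).
by rewrite [in LHS](addrAC _ (al2 *: _) (al5 *: _)).
Qed.

Lemma triple_xy1 (C : starAlgType R) (x y : C) :
  triple x (star y) 1 = mix (al1 + al2 + al4) (al3 + al5 + al6) x y.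
Proof.
rewrite /sum_triple /mix starK !mulr1 !mul1r !scalerDl !addrA.
by do 2 congr (_ + _); rewrite addrAC.
Qed.

(** With [q = 1 - Phi 1], every term of [triple x (Phi 1) (Phi 1)] has a factor
    [Phi 1] on its left or right end, so [q] compresses it to 0; and by
    surjectivity these triple products exhaust [B]. *)
Lemma Phi_unital : Phi 1 = 1.
Proof.
case: Phi_bij => g gK Kg; case: Phi1_proj => se ee.
pose e := Phi 1; have eE : e * e = e by rewrite -expr2 -ee.
have [q qE] : exists q, q = 1 - e by exists (1 - e).
have qe : q * e = 0 by rewrite qE mulrBl mul1r eE subrr.
have eq : e * q = 0 by rewrite qE mulrBr mulr1 eE subrr.
have compress (y : B) : q * y * q = 0.
  have: triple (Phi (alpha^-1 *: g y)) (Phi 1) (Phi 1) = y.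
    by rewrite -Phi_triple triple_x11 scalerA divff // scale1r Kg.
  rewrite /sum_triple -se -/e; set x := Phi _ => <-.
  rewrite !mulrDr !mulrDl -!(scalerAr, scalerAl) -!mulrA eq.
  by rewrite ![q * (e * _)]mulrA qe !(mulr0, mul0r) !scaler0 !addr0.
have /eqP: q = 0.
  have qq : q * q = q by rewrite {1}qE mulrBl mul1r eq subr0.
  by have := compress 1; rewrite mulr1 qq.
by rewrite qE subr_eq0 => /eqP.
Qed.

Lemma Phi_scale_sum x : Phi (alpha *: x) = alpha *: Phi x.
Proof. by rewrite -triple_x11 Phi_triple Phi_unital triple_x11. Qed.

Lemma Phi_star x : Phi (star x) = star (Phi x).
Proof.
apply: (scalerI alpha_neq0).
by rewrite -Phi_scale_sum -triple_1x1 Phi_triple Phi_unital triple_1x1.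
Qed.

Lemma mix_star_ring_isomorphism s t :
  prime_algebra A -> (exists p : A, nontrivial_projection p) ->
  s + t = alpha -> s - t <> 0 ->
  (forall a, Phi ((s - t) *: a) = (s - t) *: Phi a) ->
  (forall x y, Phi (mix s t x y) = mix s t (Phi x) (Phi y)) ->
  star_ring_isomorphism Phi.
Proof.
move=> primeA [p [[_ pp] p0 p1]] stE /eqP dt0 PhiDl Phi_mix.
have st0 : s + t != 0 by rewrite stE.
have PhiD : forall x y, Phi (x + y) = Phi x + Phi y.
  exact: (mix_isomorphism_additive (s := s) (t := t) (p := p)).
split=> //; first exact: Phi_star.
apply: (mix_isomorphism_multiplicative (s := s) (t := t)) => // x.
by rewrite stE Phi_scale_sum.
Qed.

End Triple.

Unset Implicit Arguments.
Set Strict Implicit.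

Theorem theorem2p2 (R : realType)
    (alpha1 alpha2 alpha3 alpha4 alpha5 alpha6 : R[i])
    (sum_alpha_neq0 :
       alpha1 + alpha2 + alpha3 + alpha4 + alpha5 + alpha6 <> 0)
    (A B : starAlgType R)
    (primeA : prime_algebra A)
    (projA : exists p : A, nontrivial_projection p)
    (Phi : A -> B)
    (Phi_bij : bijective Phi)
    (Phi_triple : forall a b c : A,
       Phi (sum_triple alpha1 alpha2 alpha3 alpha4 alpha5 alpha6 a b c) =
       sum_triple alpha1 alpha2 alpha3 alpha4 alpha5 alpha6
         (Phi a) (Phi b) (Phi c))
    (Phi1_proj : projection (Phi 1))
    (Phi_scal :
       let lambda := (alpha1 + alpha2 + alpha3) - (alpha4 + alpha5 + alpha6) in
       let mu := (alpha1 + alpha3 + alpha5) - (alpha2 + alpha4 + alpha6) in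
       let kappa := (alpha1 + alpha2 + alpha4) - (alpha3 + alpha5 + alpha6) in
       [\/ lambda <> 0 /\ (forall a : A, Phi (lambda *: a) = lambda *: Phi a),
           mu <> 0 /\ (forall a : A, Phi (mu *: a) = mu *: Phi a)
         | kappa <> 0 /\ (forall a : A, Phi (kappa *: a) = kappa *: Phi a)]) :
  star_ring_isomorphism Phi.
Proof.
move/eqP in sum_alpha_neq0.
have Phi1 := Phi_unital sum_alpha_neq0 Phi_bij Phi_triple Phi1_proj.
have PhiS := Phi_star sum_alpha_neq0 Phi_bij Phi_triple Phi1_proj.
have concl := mix_star_ring_isomorphism sum_alpha_neq0 Phi_bij Phi_triple
  Phi1_proj primeA projA.
case: Phi_scal => [] [k0 PhiK].
- apply: concl k0 PhiK _ => [|x y]; first by rewrite !addrA.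
  by rewrite -!triple_x1y Phi_triple Phi1.
- apply: concl k0 PhiK _ => [|x y].
    rewrite -!addrA; congr (_ + _); rewrite [RHS]addrCA; congr (_ + _).
    by rewrite addrCA; congr (_ + _); rewrite addrCA.
  by rewrite -!triple_1xy Phi_triple Phi1 PhiS.
- apply: concl k0 PhiK _ => [|x y].
    by rewrite !addrA; do 2 congr (_ + _); rewrite addrAC.
  by rewrite -!triple_xy1 Phi_triple Phi1 PhiS.
Qed.
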